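(* Let $F\colon\mathbb{R}\to\mathbb{R}$ be a continuous map which is a lifting of a continuous circle map of degree $d\geq 1$, i.e. $d\ge 1$ is an integer and $F(x+1)=F(x)+d$ for all $x\in\mathbb{R}$. Assume that $F$ has a periodic orbit $P\subset\mathbb{R}$ of period $n$ such that $\max P-\min P>1$. Then: (1) if $d=1$, the rotation interval of $F$ contains the interval $[-\tfrac{1}{n},\tfrac{1}{n}]$ and, consequently, $F$ has periodic points of all periods, that is, for every integer $m\geq 1$ there is a point $x\in\mathbb{R}$ that is periodic for $F$ with period $m$; (2) if $d\geq 2$, $F$ also has periodic points of all periods, that is, for every integer $m\geq 1$ there is a point $x\in\mathbb{R}$ that is periodic for $F$ with period $m$.
   Context: Let $\mathbb{S}=\mathbb{R}/\mathbb{Z}$ and let $\pi\colon\mathbb{R}\to\mathbb{S}$ be the canonical projection. A lifting of a continuous map $f\colon\mathbb{S}\to\mathbb{S}$ is a continuous map $F\colon\mathbb{R}\to\mathbb{R}$ with $f\circ\pi=\pi\circ F$. The degree of $f$ (or of $F$) is the integer $d$ such that $F(x+1)=F(x)+d$ for all $x\in\mathbb{R}$. A point $x\in\mathbb{R}$ is periodic for $F$ if $F^k(x)=x$ for some integer $k\geq 1$ (equality in $\mathbb{R}$, not modulo 1); its period is the least such $k$. A periodic orbit of $F$ is the finite set $\{F^i(x)\mid i\geq 0\}$ for some periodic point $x$; its period is the period of $x$ (equivalently its cardinality). When $d=1$, the rotation number of $x\in\mathbb{R}$ is $\rho_F(x)=\lim_{k\to+\infty}\frac{F^k(x)-x}{k}$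 when this limit exists. The set of all rotation numbers $\rho_F(x)$ (over those $x\in\mathbb{R}$ for which the limit exists) is a compact interval, called the rotation interval of $F$. *)

(* Defs.v *)
From mathcomp Require Import all_boot all_order all_algebra.
From mathcomp Require Import all_classical all_reals all_analysis.
Import Order.TTheory GRing.Theory Num.Theory numFieldNormedType.Exports.

Set Implicit Arguments.
Unset Strict Implicit.
Unset Printing Implicit Defensive.

Local Open Scope classical_set_scope.
Local Open Scope ring_scope.

(* The circle is R/Z: the liftings of the continuous circle maps of degree [d]
   are exactly the continuous maps of the real line that satisfy the functional
   equation below. *)
Definition lifting_of_degree (R : realType) (d : int) (F : R -> R) : Prop :=
  continuous F /\ forall x : R, F (x + 1) = F x + d%:~R.

(* Equality is in [R], not modulo 1. *)
Definition periodic_point (R : realType) (F : R -> R) (k : nat) (x : R) : Prop :=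
  [/\ (0 < k)%N, iter k F x = x &
      forall j : nat, (0 < j < k)%N -> iter j F x <> x].

Definition periodic_orbit (R : realType) (F : R -> R) (n : nat) (P : set R) :
    Prop :=
  exists2 x : R, periodic_point F n x & P = range (fun i : nat => iter i F x).

Definition is_max (R : realType) (P : set R) (M : R) : Prop :=
  P M /\ forall y : R, P y -> y <= M.

Definition is_min (R : realType) (P : set R) (m : R) : Prop :=
  P m /\ forall y : R, P y -> m <= y.

(* A relation rather than a function, since the limit need not exist. The term
   of index [k = 0] is [0 / 0 = 0] and does not affect the limit. *)
Definition rotation_number (R : realType) (F : R -> R) (x rho : R) : Prop :=
  (iter k F x - x) / k%:R @[k --> \oo] --> rho.

(* For a lifting of degree 1 this set is a compact interval. *)
Definition rotation_interval (R : realType) (F : R -> R) : set R :=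
  [set rho | exists x : R, rotation_number F x rho].

Definition all_periods (R : realType) (F : R -> R) : Prop :=
  forall m : nat, (1 <= m)%N -> exists x : R, periodic_point F m x.

(* Main.v *)
Require Import Defs.
From mathcomp Require Import all_boot all_order all_algebra.
From mathcomp Require Import all_classical all_reals all_analysis.
From mathcomp Require Import ring lra zify.
Import Order.TTheory GRing.Theory Num.Theory numFieldNormedType.Exports.

Set Implicit Arguments.
Unset Strict Implicit.
Unset Printing Implicit Defensive.

Local Open Scope classical_set_scope.
Local Open Scope ring_scope.

(** Write a = min P and b = max P, so a + 1 < b, and some iterate of F carries
    a to b while another carries b to a. All orbits are produced by itineraries:
    if every interval of a sequence covers the next one under F, in the sense of
    [covers], then some point follows the sequence ([covers_forever]), and if the
    sequence closes up then some point follows it periodically ([covers_loop]).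

    Rotation numbers, degree 1. Start at a and follow its orbit up to b; since
    b > a + 1, drop to a + 1 there and follow the orbit of a + 1. In n steps this
    pseudo-orbit, which only ever jumps downwards, gains 1 ([climb]); the mirror
    image of it loses 1 starting from b ([descend]). Take an interval whose upper
    end follows the climbing sequence (shifted up by a large integer M) and whose
    lower end follows the descending one (shifted down by M): after n steps the
    images cover the initial interval enlarged by 1 on both sides, hence its
    translates by -1, 0 and 1. When |n rho| <= 1, the integer parts of q n rho
    have increments -1, 0 or 1, so some point stays at bounded distance from
    i rho at time i, and its rotation number is rho ([drift_rotation_numbers]).

    Periods, degree d >= 2. Let p be the last fixed point before a, and let
    w = b - m be the translate of b in [p, p + 1). Since F expands translations,
    F w < p, hence w > a because F lies above the diagonal on (p, a]. So w
    separates a from b, and some point y of P with p < y <= w jumps beyond w: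
    the intervals [p, y] and [y, w] form a horseshoe with F p = p and F w < p,
    which has periodic points of all periods ([expanding_all_periods]).

    Periods, degree 1. The orbits joining a to b and b to a, together with their
    translates, show that for every t some point of [t - 1, t] is sent above t
    and some point of [t, t + 1] is sent below t ([drift_up], [drift_down]).
    Let p be a fixed point and w the last point before p + 1 with F w = p. Either
    there is a horseshoe, or there are y in (w - 1, p), w' in (p, w] and s > w with
    F y >= s > w and F w' < y such that [w, s] covers itself; then the chain
    [w', w] -> [y, p] -> [w, s] -> ... -> [w, s] -> [w', w] closes up in any
    number of steps >= 2 while visiting [y, p] once ([drift_all_periods]). *)

(** * Interval coverings and itineraries *)

(** By the intermediate value theorem this implies that g(I) contains J. Asking
    for two witnesses anywhere in I, instead of for values at its end points,
    makes the notion independent of the orientation of g and easy to compose. *)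
Definition covers (R : realType) (g : R -> R) (I J : R * R) : Prop :=
  exists u v, [/\ I.1 <= u <= I.2, I.1 <= v <= I.2, g u <= J.1 & J.2 <= g v].

Lemma ivt_in (R : realType) (g : R -> R) (l h u v c : R) :
  continuous g -> l <= u <= h -> l <= v <= h -> g u <= c -> c <= g v ->
  exists2 x, l <= x <= h & g x = c.
Proof.
move=> cg /andP[lu uh] /andP[lv vh] gu gv.
have sub a b : {within `[a, b], continuous g} by apply: continuous_subspaceT.
have [uv|/ltW vu] := leP u v.
  have [|x xi gx] := IVT uv (sub u v) (v := c).
    by rewrite ge_min gu le_max gv orbT.
  by exists x => //; move: xi; rewrite in_itv /=; lra.
have [|x xi gx] := IVT vu (sub v u) (v := c).
  by rewrite ge_min gu le_max gv orbT.
by exists x => //; move: xi; rewrite in_itv /=; lra.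
Qed.

Lemma ivt_last (R : realType) (g : R -> R) (u v c : R) :
  continuous g -> u <= v -> g u <= c -> c < g v ->
  exists w, [/\ u <= w, w < v, g w = c & forall x, w < x <= v -> c < g x].
Proof.
move=> cg uv gu gv.
pose A := `[u, v] `&` [set x | g x <= c].
have cA : compact A.
  apply: compact_closedI; first exact: segment_compact.
  by apply: (@preimage_closed _ _ g [set y | y <= c]) => //; exact: closed_le.
have [||w] := @compact_EVT_max _ R id A _ cA.
- by exists u; split => //=; rewrite in_itv /= lexx.
- by apply: continuous_subspaceT => x; exact: cvg_id.
move=> /set_mem[/=]; rewrite in_itv /= => /andP[uw wv] gw wmax.
have last x : w < x <= v -> c < g x.
  move=> /andP[wx xv]; rewrite ltNge; apply/negP => gx.
  have : x <= w; last by rewrite leNgt wx.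
  by apply: wmax; apply/mem_set; split => //=; rewrite in_itv /=; lra.
have wltv : w < v by rewrite lt_neqAle wv andbT; apply/eqP => e; rewrite e in gw; lra.
exists w; split => //; apply/eqP; rewrite eq_le gw /= leNgt; apply/negP => gwc.
have [x /andP[wx xv] gx] := @ivt_in _ g w v w v c cg ltac:(lra) ltac:(lra) gw (ltW gv).
have [xw|xw] := ltP w x; first by have := last x; rewrite xw xv gx ltxx; move=> /(_ isT).
have e : x = w by lra.
by move: gwc; rewrite -e gx ltxx.
Qed.

Lemma ivt_first (R : realType) (g : R -> R) (u v c : R) :
  continuous g -> u <= v -> g u < c -> c <= g v ->
  exists w, [/\ u < w, w <= v, g w = c & forall x, u <= x < w -> g x < c].
Proof.
move=> cg uv gu gv.
have cg' : continuous (fun x => - g (- x)).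
  move=> x; apply: cvgN; apply: (@continuous_comp _ _ _ (fun x => - x) g).
    exact: opp_continuous.
  exact: cg.
have [|||w [vw wu gw last]] := @ivt_last _ _ (- v) (- u) (- c) cg'.
- by rewrite lerN2.
- by rewrite opprK lerN2.
- by rewrite opprK ltrN2.
exists (- w); split; [lra|lra| by apply: oppr_inj|].
move=> x xw; have := last (- x); rewrite opprK ltrN2; apply; lra.
Qed.

(** The last point before [v] at level [c], and then the first point after it at
    level [d], bound a piece on which [g] stays between the two levels. *)
Lemma narrow_increasing (R : realType) (g : R -> R) (u v c d : R) :
  continuous g -> u <= v -> g u <= c -> c <= d -> d <= g v ->
  exists s t, [/\ u <= s, s <= t, t <= v, g s = c & g t = d] /\
    forall x, s <= x <= t -> c <= g x <= d.
Proof.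
move=> cg uv gu cd gv; have [cd'|dc] := ltP c d; last first.
  have e : c = d by lra.
  have [x xi gx] := @ivt_in _ g u v u v c cg ltac:(lra) ltac:(lra) gu ltac:(lra).
  exists x, x; split; [split; lra|move=> y yx].
  have -> : y = x by lra.
  lra.
have [s [us sv gs lasts]] := @ivt_last _ g u v c cg uv gu ltac:(lra).
have [t [st tv gt firstt]] := @ivt_first _ g s v d cg ltac:(lra) ltac:(lra) gv.
exists s, t; split; first by split => //; lra.
move=> x /andP[sx xt]; apply/andP; split.
  have [/eqP e|ne] := boolP (x == s); first by rewrite e gs.
  apply/ltW/lasts; have : s < x by rewrite lt_neqAle eq_sym ne sx.
  lra.
have [/eqP e|ne] := boolP (x == t); first by rewrite e gt.
apply/ltW/firstt; have : x < t by rewrite lt_neqAle ne xt.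
lra.
Qed.

(** Trimming an interval so that its image is no longer too big: this is what
    lets a covering be prolonged while the points stay in the prescribed
    intervals at the earlier times. *)
Lemma covers_narrow (R : realType) (g : R -> R) (I J : R * R) :
  continuous g -> J.1 <= J.2 -> covers g I J ->
  exists K : R * R, [/\ I.1 <= K.1, K.2 <= I.2, covers g K J &
    forall x, K.1 <= x <= K.2 -> J.1 <= g x <= J.2].
Proof.
move=> cg J12 [u [v [uI vI gu gv]]].
have [uv|/ltW vu] := leP u v.
  have [s [t [[us st tv gs gt] itv]]] := narrow_increasing cg uv gu J12 gv.
  exists (s, t) => /=; split => //; [lra|lra|].
  exists s, t => /=; split; lra.
have cgN : continuous (fun x => - g x) by move=> x; apply: cvgN; exact: cg.
have [|||s [t [[us st tv gs gt] itv]]] :=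
  @narrow_increasing _ (fun x => - g x) _ _ (- J.2) (- J.1) cgN vu; try by lra.
exists (s, t) => /=; split => //; [lra|lra| |].
  exists t, s => /=; split; lra.
by move=> x /itv; lra.
Qed.

Lemma covers_comp (R : realType) (f g : R -> R) (I J K : R * R) :
  continuous f -> covers f I J -> covers g J K -> covers (g \o f) I K.
Proof.
move=> cf [a [b [aI bI fa fb]]] [u [v [uJ vJ gu gv]]].
have [u' u'I fu] := @ivt_in _ f I.1 I.2 a b u cf aI bI ltac:(lra) ltac:(lra).
have [v' v'I fv] := @ivt_in _ f I.1 I.2 a b v cf aI bI ltac:(lra) ltac:(lra).
by exists u', v'; split => //=; rewrite ?fu ?fv.
Qed.

Lemma continuous_iter (R : realType) (F : R -> R) (k : nat) :
  continuous F -> continuous (iter k F).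
Proof.
move=> cF; elim: k => [|k IH] x; first exact: cvg_id.
by apply: (@continuous_comp _ _ _ (iter k F) F); [exact: IH|exact: cF].
Qed.

Lemma covers_chain (R : realType) (F : R -> R) (I : nat -> R * R) (k : nat) :
  continuous F -> (forall i, (I i).1 <= (I i).2) ->
  (forall i, (i < k)%N -> covers F (I i) (I i.+1)) ->
  exists K : R * R, covers (iter k F) K (I k) /\
    forall x, K.1 <= x <= K.2 ->
      forall i, (i <= k)%N -> (I i).1 <= iter i F x <= (I i).2.
Proof.
move=> cF I12; elim: k => [|k IH] chain.
  exists (I 0%N); split.
    by exists (I 0%N).1, (I 0%N).2 => /=; rewrite !lexx I12.
  by move=> x xI i; rewrite leqn0 => /eqP ->.
have [|K [cK itK]] := IH; first by move=> i ik; apply: chain; exact: ltnW.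
have cov : covers (iter k.+1 F) K (I k.+1).
  apply: covers_comp cK (chain k (leqnn _)); exact: continuous_iter.
have [L [KL1 KL2 cL itL]] := covers_narrow (continuous_iter (k := k.+1) cF) (I12 _) cov.
exists L; split => // x xL i; rewrite leq_eqVlt => /orP[/eqP ->|]; first exact: itL.
by rewrite ltnS; apply: itK; lra.
Qed.

(** The first interval contains a piece that follows the loop and whose image by
    the last iterate covers the whole first interval, so the graph of that iterate
    meets the diagonal over the piece. *)
Lemma covers_loop (R : realType) (F : R -> R) (I : nat -> R * R) (k : nat) :
  continuous F -> (forall i, (I i).1 <= (I i).2) ->
  (forall i, (i < k)%N -> covers F (I i) (I i.+1)) ->
  covers F (I k) (I 0%N) ->
  exists2 x, iter k.+1 F x = x &
    forall i, (i <= k)%N -> (I i).1 <= iter i F x <= (I i).2.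
Proof.
move=> cF I12 chain back.
have [K [cK itK]] := covers_chain (k := k) cF I12 chain.
have [u [v [uK vK Fu Fv]]] := covers_comp (continuous_iter (k := k) cF) cK back.
have cd : continuous (fun x => iter k.+1 F x - x).
  by move=> x; apply: cvgB; [exact: continuous_iter|exact: cvg_id].
have uI := itK u uK 0%N isT; have vI := itK v vK 0%N isT; rewrite /= in uI vI Fu Fv.
have [||x xK /= Fx] := @ivt_in _ _ K.1 K.2 u v 0 cd uK vK.
- by move=> /=; lra.
- by move=> /=; lra.
by exists x; [rewrite /=; lra|exact: itK].
Qed.

(** Points that follow longer and longer initial segments accumulate, by
    compactness, at a point that follows the whole sequence. *)
Lemma covers_forever (R : realType) (F : R -> R) (I : nat -> R * R) :
  continuous F -> (forall i, (I i).1 <= (I i).2) ->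
  (forall i, covers F (I i) (I i.+1)) ->
  exists x, forall i, (I i).1 <= iter i F x <= (I i).2.
Proof.
move=> cF I12 chain.
have /choice[x_ xI] k : exists x, forall i, (i <= k)%N -> (I i).1 <= iter i F x <= (I i).2.
  have [K [[u [_ [uK _ _ _]]] itK]] := covers_chain (k := k) cF I12 (fun i _ => chain i).
  by exists u; exact: itK.
have [] := @segment_compact _ (I 0%N).1 (I 0%N).2 (x_ @ \oo).
  by exists 0%N => // k _ /=; rewrite in_itv /=; exact: (xI k 0%N (leq0n k)).
move=> x [_ clx]; exists x => i.
pose B := [set y | (I i).1 <= iter i F y <= (I i).2].
have cB : closed B.
  have -> : B = iter i F @^-1` `[(I i).1, (I i).2].
    by apply/seteqP; split => y /=; rewrite in_itv.
  apply: preimage_closed; last exact: interval_closed.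
  by move=> y _; exact: continuous_iter.
apply: cB => U Ux; apply: clx => //.
by exists i => // k /= ik; exact: xI.
Qed.

(** * Horseshoes and excursions *)

(** The loop of length m that visits [B] once and then stays in [A] gives period m:
    an earlier return would put its base point in both intervals and the image of
    this point in [A]. *)
Lemma horseshoe_all_periods (R : realType) (F : R -> R) (A B : R * R) :
  continuous F -> A.1 <= A.2 -> B.1 <= B.2 ->
  covers F A A -> covers F A B -> covers F B A -> covers F B B ->
  (forall x, A.1 <= x <= A.2 -> B.1 <= x <= B.2 -> ~ (A.1 <= F x <= A.2)) ->
  all_periods F.
Proof.
move=> cF hA hB AA AB BA BB sep [//|k] _.
pose I i := if i is 0%N then B else A.
have [|||x Fx xI] := @covers_loop _ F I k cF.
- by case.
- by case.
- by case: k.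
exists x; split => // j /andP[j0 jk] Fjx.
have xA : A.1 <= x <= A.2.
  by move: (xI j jk); rewrite Fjx; case: j j0 {jk Fjx}.
apply: (sep x xA (xI 0%N isT)).
apply: (xI 1%N); lia.
Qed.

(** The loop A -> B -> D -> ... -> D -> A, of any length at least 2, visits once
    the interval [B], which lies on the left of the two others; this forces the
    period to be the length of the loop. The fixed point [p] gives period 1. *)
Lemma excursion_all_periods (R : realType) (F : R -> R) (A B D : R * R) (p : R) :
  continuous F -> F p = p -> A.1 <= A.2 -> B.1 <= B.2 -> D.1 <= D.2 ->
  B.2 < A.1 -> B.2 < D.1 ->
  covers F A B -> covers F B A -> covers F B D -> covers F D D -> covers F D A ->
  all_periods F.
Proof.
move=> cF Fp hA hB hD BltA BltD AB BA BD DD DA [//|[_|k _]].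
  by exists p; split => // -[|[]].
pose I i := match i with 0%N => A | 1%N => B | _ => D end.
have [|||x Fx xI] := @covers_loop _ F I k.+1 cF.
- by case=> [|[]].
- by case=> [|[]].
- by case: k.
exists x; split => // j /andP[j0 jk] Fjx.
have /= xB := xI 1%N isT.
have /= xA := xI 0%N isT.
have Fj1x : iter j.+1 F x = F x by rewrite iterS Fjx.
have [jk1|] := boolP (j.+1 <= k.+1)%N; last first.
  move=> jk1; have e : j = k.+1 by lia.
  by move: Fx; rewrite -e Fj1x => Fx; lra.
by have := xI _ jk1; rewrite Fj1x; case: j j0 {jk Fjx Fj1x jk1} => //= j _; lra.
Qed.

Lemma up_horseshoe (R : realType) (F : R -> R) (p y w : R) :
  continuous F -> p <= y <= w -> p < w -> F p <= p -> w <= F y -> F w <= p ->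
  all_periods F.
Proof.
move=> cF yi pw Fp Fy Fw.
apply: (@horseshoe_all_periods _ F (p, y) (y, w)) => //=; try lra.
- by exists p, y; split => /=; lra.
- by exists p, y; split => /=; lra.
- by exists w, y; split => /=; lra.
- by exists w, y; split => /=; lra.
move=> x xl xr; have e : x = y by lra.
rewrite e => Fyi; have e' : y = w by lra.
by rewrite e' in Fy; lra.
Qed.

Lemma down_horseshoe (R : realType) (F : R -> R) (p y w : R) :
  continuous F -> y <= w <= p -> y < p -> p <= F p -> F w <= y -> p <= F y ->
  all_periods F.
Proof.
move=> cF yi pw Fp Fw Fy.
apply: (@horseshoe_all_periods _ F (w, p) (y, w)) => //=; try lra.
- by exists w, p; split => /=; lra.
- by exists w, p; split => /=; lra.
- by exists w, y; split => /=; lra.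
- by exists w, y; split => /=; lra.
move=> x xl xr; have e : x = w by lra.
rewrite e => Fyi; have e' : y = w by lra.
by rewrite -e' in Fw; lra.
Qed.

(** * Orbits and translations *)

Lemma orbit_exits (R : Type) (F : R -> R) (Q : R -> Prop) (x : R) (j : nat) :
  Q x -> ~ Q (iter j F x) -> exists i, Q (iter i F x) /\ ~ Q (iter i.+1 F x).
Proof.
move=> Qx; elim: j => [//|j IH] nQ.
by have [Qj|/IH//] := pselect (Q (iter j F x)); exists j.
Qed.

Lemma periodic_orbit_connected (R : realType) (F : R -> R) (n : nat) (P : set R) (y z : R) :
  periodic_orbit F n P -> P y -> P z ->
  (forall i, P (iter i F y)) /\ exists2 j, (j <= n)%N & iter j F y = z.
Proof.
move=> [x [n0 Fx _] ->] [i _ <-] [k _ <-]; split.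
  by move=> l; exists (l + i)%N; rewrite ?iterD.
have itM q : iter (q * n) F x = x.
  by elim: q => [//|q IH]; rewrite mulSn iterD IH.
have itmod m : iter (m %% n) F x = iter m F x.
  by rewrite {2}(divn_eq m n) addnC iterD itM.
exists ((k + i * n - i) %% n)%N; first by rewrite ltnW // ltn_pmod.
rewrite -iterD -itmod modnDml subnK; last by nia.
by rewrite itmod iterD itM.
Qed.

Lemma lifting_shift (R : realType) (d : int) (F : R -> R) (x : R) (m : int) :
  lifting_of_degree d F -> F (x + m%:~R) = F x + d%:~R * m%:~R.
Proof.
move=> [_ F1].
have nat_shift (k : nat) z : F (z + k%:R) = F z + d%:~R * k%:R.
  elim: k => [|k IH]; first by rewrite mulr0 !addr0.
  by rewrite -natr1 addrA F1 IH; ring.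
case: (intP m) => [|k|k].
- by rewrite mulr0z mulr0 !addr0.
- exact: nat_shift.
have := nat_shift k.+1 (x - k.+1%:R); rewrite subrK => ->.
by rewrite mulrNz /=; ring.
Qed.

Lemma degree_one_shift (R : realType) (F : R -> R) (x : R) (m : int) :
  lifting_of_degree 1 F -> F (x + m%:~R) = F x + m%:~R.
Proof. by move=> hF; rewrite (lifting_shift _ _ hF) mul1r. Qed.

(** * Periods in degree at least two *)

(** The translates of [a] and [b] are driven apart by the expansion: this yields a
    fixed point on the left of [a] and a point between [a] and [b] that is
    sent below this fixed point. *)
Lemma expanding_all_periods (R : realType) (d : int) (F : R -> R) (a b : R)
    (j : nat) :
  2 <= d -> lifting_of_degree d F -> iter j F a = b ->
  (forall i, a <= iter i F a) -> a < F a -> F b <= b -> a + 1 < b ->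
  all_periods F.
Proof.
move=> d2 hF Fja aF Fa Fb ab; have [cF _] := hF.
have D2 : 2 <= d%:~R :> R by rewrite (ler_int R 2).
set D : R := d%:~R in D2.
have shift (x : R) (k : nat) : F (x - k%:R) = F x - D * k%:R.
  by have := lifting_shift x (- k%:Z) hF; rewrite mulrNz mulrN.
have cd : continuous (fun x => F x - x).
  by move=> x; apply: cvgB; [exact: cF|exact: cvg_id].
(* F x - x decreases by d - 1 >= 1 when x decreases by 1, so it is <= 0 at a - k. *)
pose k := Num.bound (F a - a).
have ka : F a - a < k%:R by apply: archi_boundP; lra.
have k0 : 0 <= k%:R :> R by [].
have [|||p [_ pa Fp above]] := @ivt_last _ (fun x => F x - x) (a - k%:R) a 0 cd.
- lra.
- by rewrite /= shift; nra.
- by rewrite /=; lra.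
have {}Fp : F p = p by exact: subr0_eq.
rewrite /= in above.
(* b - m is in [p, p + 1), and m >= 1 since b - p > b - a > 1; hence
   F (b - m) <= b - d m <= (b - m) - m < p. *)
have /andP[mb bm] := truncn_itv (x := b - p) ltac:(lra).
set m := Num.truncn (b - p) in mb bm.
have m1 : 1 <= m%:R :> R.
  rewrite (ler_nat R 1) -ltnS -(ltr_nat R) /=.
  by apply: lt_trans bm; lra.
rewrite -natr1 in bm.
have Fw : F (b - m%:R) < p by rewrite shift; nra.
set w := b - m%:R in Fw.
have pw : p < w.
  rewrite lt_neqAle; apply/andP; split; last by rewrite /w; lra.
  by apply/eqP => e; rewrite -e Fp ltxx in Fw.
have aw : a < w by rewrite ltNge; apply/negP => wa; have := above w; lra.
have [||i [/= Fi Fi1]] := @orbit_exits R F (fun x => x <= w) a j.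
- exact: ltW.
- by rewrite Fja /w; lra.
have := aF i => ai.
by apply: (@up_horseshoe _ F p (iter i F a) w) => //; lra.
Qed.

(** * Periods in degree one *)

(** The hypotheses say that no half-line is mapped into itself, i.e. that 0 is
    interior to the rotation interval. Below, [w] is the last point before p + 1
    at level p, and [y] is where F is largest on [w - 1, p]. If no horseshoe is
    visible, F stays below w on [p, w]; then the hypotheses applied at the
    levels w, y and F y provide the coverings needed by [excursion_all_periods]. *)
Lemma drift_all_periods (R : realType) (F : R -> R) :
  continuous F -> (forall x, F (x + 1) = F x + 1) ->
  (forall t : R, exists2 y, t - 1 <= y <= t & t < F y) ->
  (forall t : R, exists2 w, t <= w <= t + 1 & F w < t) ->
  all_periods F.
Proof.
move=> cF F1 up down.
have [p Fp] : exists p, F p = p.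
  have cd : continuous (fun x => F x - x).
    by move=> x; apply: cvgB; [exact: cF|exact: cvg_id].
  have [y yi Fy] := up 0; have [w wi Fw] := down 0.
  have [||p _ /= Fp] := @ivt_in _ _ (-1) 1 w y 0 cd ltac:(lra) ltac:(lra).
  - by move=> /=; lra.
  - by move=> /=; lra.
  by exists p; lra.
have [w0 w0i Fw0] := down p.
have [||w [w0w wp Fw last]] := @ivt_last _ F w0 (p + 1) p cF ltac:(lra).
- lra.
- by rewrite F1; lra.
have pw : p < w.
  rewrite lt_neqAle; apply/andP; split; last by lra.
  apply/eqP => e; have e1 : w0 = p by lra.
  by rewrite e1 Fp in Fw0; lra.
have [[y yi Fy]|nohorse] := pselect (exists2 y, p <= y <= w & w <= F y).
  by apply: (@up_horseshoe _ F p y w) => //; lra.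
have low x : p <= x <= w -> F x < w.
  by move=> xi; rewrite ltNge; apply/negP => Fx; apply: nohorse; exists x.
have [||y yi ymax] := @EVT_max _ F (w - 1) p.
- lra.
- exact: continuous_subspaceT.
rewrite in_itv /= in yi.
have {}ymax x : w - 1 <= x <= p -> F x <= F y.
  by move=> xi; apply: ymax; rewrite in_itv.
have Fy : w < F y.
  have [y1 y1i Fy1] := up w.
  have [py1|y1p] := leP p y1; first by have := low y1; lra.
  by have := ymax y1; lra.
have yp : y < p.
  by rewrite lt_neqAle; apply/andP; split; [apply/eqP => e; rewrite e in Fy|]; lra.
have wy : w - 1 < y.
  rewrite lt_neqAle; apply/andP; split; last by lra.
  apply/eqP => e; have := F1 y; rewrite -e subrK Fw => Fe; rewrite -e in Fy; lra.
have [w' w'i Fw'] := down y.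
(* A point w' on the left of p would give a horseshoe turned upside down, and F
   exceeds p on the right of w; so w' is in (p, w]. *)
have [w'p|pw'] := leP w' p; first by apply: (@down_horseshoe _ F p y w') => //; lra.
have [ww'|w'w] := ltP w w'; first by have := last w'; lra.
(* The image of [y, p] covers [w, F y]; this interval has to be cut at some s for
   which [w, s] covers itself. If y + 1 <= F y, then s = y + 1 works, because
   F (y + 1) = F y + 1. Otherwise s = F y works: a point of [F y - 1, F y] that
   jumps above F y is neither in [w - 1, p], where F <= F y, nor in [p, w], where
   F < w. *)
have [s [ws sFy [y2 y2i Fy2]]] :
    exists s, [/\ w < s, s <= F y & exists2 y2, w <= y2 <= s & s <= F y2].
  have [y1F|Fy1] := leP (y + 1) (F y).
    exists (y + 1); split => //; first by lra.
    by exists (y + 1); [lra|rewrite F1; lra].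
  exists (F y); split => //; have [y2 y2i Fy2] := up (F y).
  exists y2; last by lra.
  have [y2p|py2] := leP y2 p; first by have := ymax y2; lra.
  by have [y2w|wy2] := leP y2 w; [have := low y2; lra|lra].
apply: (@excursion_all_periods _ F (w', w) (y, p) (w, s) p) => //=; try lra.
- by exists w', w; split => /=; lra.
- by exists p, y; split => /=; lra.
- by exists p, y; split => /=; lra.
- by exists w, y2; split => /=; lra.
- by exists w, y2; split => /=; lra.
Qed.

(** The last translate of [a] that is at most [t] is carried above [t]; a point of its
    orbit that jumps over [t] can be translated into [t - 1, t], since
    translating it up by an integer also raises its image. *)
Lemma drift_up (R : realType) (F : R -> R) (a b : R) (j : nat) (t : R) :
  lifting_of_degree 1 F -> iter j F a = b -> a + 1 < b ->
  exists2 y, t - 1 <= y <= t & t < F y.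
Proof.
move=> hF Fja ab.
have shift (x : R) (m : int) := degree_one_shift x m hF.
have shift_iter i (x : R) (m : int) : iter i F (x + m%:~R) = iter i F x + m%:~R.
  by elim: i => //= i ->; rewrite shift.
have /andP[mt tm] := floor_itv (t - a); set m := Num.floor (t - a) in mt tm.
rewrite intrD in tm.
have [||i [/= Fi Fi1]] := @orbit_exits R F (fun x => x <= t) (a + m%:~R) j.
- lra.
- by rewrite shift_iter Fja; lra.
set y := iter i F _ in Fi Fi1.
have /andP[ky yk] := floor_itv (t - y); set k := Num.floor (t - y) in ky yk.
have k0 : 0 <= k%:~R :> R by rewrite (ler_int R 0) floor_ge_int; lra.
rewrite intrD in yk.
by exists (y + k%:~R); rewrite ?shift; lra.
Qed.

Lemma drift_down (R : realType) (F : R -> R) (a b : R) (j : nat) (t : R) :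
  lifting_of_degree 1 F -> iter j F b = a -> a + 1 < b ->
  exists2 y, t <= y <= t + 1 & F y < t.
Proof.
move=> hF Fjb ab.
have shift (x : R) (m : int) : F (x - m%:~R) = F x - m%:~R.
  by rewrite -mulrNz degree_one_shift.
have shift_iter i (x : R) (m : int) : iter i F (x - m%:~R) = iter i F x - m%:~R.
  by elim: i => //= i ->; rewrite shift.
have /andP[mt tm] := floor_itv (b - t); set m := Num.floor (b - t) in mt tm.
rewrite intrD in tm.
have [||i [/= Fi Fi1]] := @orbit_exits R F (fun x => t <= x) (b - m%:~R) j.
- lra.
- by rewrite shift_iter Fjb; lra.
set y := iter i F _ in Fi Fi1.
have /andP[ky yk] := floor_itv (y - t); set k := Num.floor (y - t) in ky yk.
have k0 : 0 <= k%:~R :> R by rewrite (ler_int R 0) floor_ge_int; lra.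
rewrite intrD in yk.
by exists (y - k%:~R); rewrite ?shift; lra.
Qed.

(** * Rotation numbers in degree one *)

(** The orbit of [a] is followed up to [b], then replaced by the orbit of a + 1
    from its start. Only downward jumps are made, so the sequence can serve as
    upper ends in a chain of coverings. *)
Lemma climb (R : realType) (F : R -> R) (a b : R) (n j : nat) :
  lifting_of_degree 1 F -> iter j F a = b -> (j <= n)%N -> a + 1 < b ->
  (forall i, a <= iter i F a <= b) ->
  exists v : nat -> R, [/\ v 0%N = a, a + 1 <= v n,
    forall r, v r.+1 <= F (v r) & forall r, a <= v r <= b + 1].
Proof.
move=> hF Fja jn ab aF.
have j0 : (0 < j)%N by case: j Fja {jn} => //= e; lra.
exists (fun r => if (r < j)%N then iter r F a else iter (r - j) F a + 1); split.
- by rewrite j0.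
- by rewrite ltnNge jn /=; have := aF (n - j)%N; lra.
- move=> r; case: (ltngtP r.+1 j) => [rj|jr|e].
  + exact: lexx.
  + have -> : (r.+1 - j = (r - j).+1)%N by lia.
    by rewrite iterS hF.2 mulr1z.
  + by rewrite -iterS e Fja subnn /=; lra.
- by move=> r; case: ifP => _; [have := aF r|have := aF (r - j)%N]; lra.
Qed.

Lemma descend (R : realType) (F : R -> R) (a b : R) (n j : nat) :
  lifting_of_degree 1 F -> iter j F b = a -> (j <= n)%N -> a + 1 < b ->
  (forall i, a <= iter i F b <= b) ->
  exists u : nat -> R, [/\ u 0%N = b, u n <= b - 1,
    forall r, F (u r) <= u r.+1 & forall r, a - 1 <= u r <= b].
Proof.
move=> hF Fjb jn ab bF.
have j0 : (0 < j)%N by case: j Fjb {jn} => //= e; lra.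
exists (fun r => if (r < j)%N then iter r F b else iter (r - j) F b - 1); split.
- by rewrite j0.
- by rewrite ltnNge jn /=; have := bF (n - j)%N; lra.
- move=> r; case: (ltngtP r.+1 j) => [rj|jr|e].
  + exact: lexx.
  + have -> : (r.+1 - j = (r - j).+1)%N by lia.
    by rewrite iterS; have := hF.2 (iter (r - j) F b - 1); rewrite subrK mulr1z; lra.
  + by rewrite -iterS e Fjb subnn /=; lra.
- by move=> r; case: ifP => _; [have := bF r|have := bF (r - j)%N]; lra.
Qed.

Lemma rotation_number_of_bounded_deviation (R : realType) (F : R -> R) (x rho c C : R) :
  (forall i, c <= iter i F x - i%:R * rho <= C) -> rotation_number F x rho.
Proof.
move=> bd; apply/cvgrPdist_le => e e0.
pose B := `|c - x| + `|C - x|.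
exists (Num.bound (B / e)).+1 => // k /= Nk.
have k0 : 0 < k%:R :> R by rewrite ltr0n; apply: leq_trans Nk.
have -> : rho - (iter k F x - x) / k%:R = (k%:R * rho - (iter k F x - x)) / k%:R.
  by field; rewrite gt_eqF.
rewrite normrM normfV (gtr0_norm k0) ler_pdivrMr //.
have Be : B < k%:R * e.
  rewrite -ltr_pdivrMr //; apply: lt_trans (archi_boundP _) _.
    by rewrite divr_ge0 ?(ltW e0) // /B addr_ge0.
  by rewrite ltr_nat.
have := bd k; rewrite ler_norml /B in Be *.
have := ler_norm (C - x); have := ler_norm (- (c - x)); rewrite normrN.
have := normr_ge0 (C - x); have := normr_ge0 (c - x); lra.
Qed.

(** Time is cut into blocks of length [n]. In the block number [q] the intervals
    are translated by the integer part of q n rho, and the ends of the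
    intervals climb and descend enough within a block to allow the translation to
    change by at most 1 at its end. *)
Lemma drift_rotation_numbers (R : realType) (F : R -> R) (a b rho : R) (n j j' : nat) :
  lifting_of_degree 1 F -> (0 < n)%N -> a + 1 < b ->
  iter j F a = b -> (j <= n)%N -> (forall i, a <= iter i F a <= b) ->
  iter j' F b = a -> (j' <= n)%N -> (forall i, a <= iter i F b <= b) ->
  - (1 / n%:R) <= rho <= 1 / n%:R -> exists x, rotation_number F x rho.
Proof.
move=> hF n0 ab Fja jn aF Fjb jn' bF rhoi; have [cF _] := hF.
have [v [v0 vn Fv vi]] := climb hF Fja jn ab aF.
have [u [u0 un Fu ui]] := descend hF Fjb jn' ab bF.
have n0R : 0 < n%:R :> R by rewrite ltr0n.
have nrho : -1 <= n%:R * rho <= 1.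
  have e : n%:R * (1 / n%:R) = 1 :> R by field; rewrite gt_eqF.
  by set q := 1 / n%:R in rhoi e; nra.
(* Since u <= b and a <= v, the intervals below are nonempty as soon as
   M >= b - a. *)
pose M : int := Num.bound (b - a).
have Mab : b - a < M%:~R by apply: archi_boundP; lra.
pose S (q : nat) : int := Num.floor (q%:R * (n%:R * rho)).
have Si q : q%:R * (n%:R * rho) - 1 <= (S q)%:~R <= q%:R * (n%:R * rho).
  by have := floor_itv (q%:R * (n%:R * rho)); rewrite -/(S q) intrD; lra.
have Sstep q : (S q)%:~R - (1 : R) <= (S q.+1)%:~R <= (S q)%:~R + (1 : R).
  have e : q.+1%:R * (n%:R * rho) = q%:R * (n%:R * rho) + n%:R * rho.
    by rewrite -natr1 mulrDl mul1r.
  apply/andP; split.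
    rewrite -[1](mulr1z 1) -intrB ler_int floor_ge_int intrB e.
    by have := floor_le (q%:R * (n%:R * rho)); rewrite -/(S q); lra.
  rewrite -[1](mulr1z 1) -intrD ler_int -ltzD1 -(ltr_int R) !intrD.
  apply: le_lt_trans (floor_le _) _.
  by have := floorD1_gt (q%:R * (n%:R * rho)); rewrite -/(S q) intrD e; lra.
pose I i := (u (i %% n)%N + (S (i %/ n)%N - M)%:~R, v (i %% n)%N + (S (i %/ n)%N + M)%:~R).
have I12 i : (I i).1 <= (I i).2.
  by rewrite /I /= intrB intrD; have := ui (i %% n)%N; have := vi (i %% n)%N; lra.
have block_end i : (n %| i.+1)%N -> (i %% n).+1 = n.
  rewrite {1}(divn_eq i n) -addnS dvdn_addr ?dvdn_mull // => /dvdn_leq => /(_ isT) ni.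
  by apply/eqP; rewrite eqn_leq ltn_pmod.
have cov i : covers F (I i) (I i.+1).
  exists (I i).1, (I i).2; rewrite !lexx I12; split => //; rewrite /I /= degree_one_shift //.
    rewrite modnS divnS //; case: ifP => [ni|_] /=; last by rewrite add0n lerD2r.
    have := Fu (i %% n)%N; rewrite (block_end _ ni) u0 add1n !intrB.
    by have := Sstep (i %/ n)%N; lra.
  rewrite modnS divnS //; case: ifP => [ni|_] /=; last by rewrite add0n lerD2r.
  have := Fv (i %% n)%N; rewrite (block_end _ ni) v0 add1n !intrD.
  by have := Sstep (i %/ n)%N; lra.
have [x xI] := covers_forever cF I12 cov.
exists x; apply: (@rotation_number_of_bounded_deviation _ _ _ _
  (a - M%:~R - 3) (b + M%:~R + 2)) => i.
have ei : i%:R * rho = (i %/ n)%:R * (n%:R * rho) + (i %% n)%:R * rho.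
  by rewrite {1}(divn_eq i n) natrD natrM; ring.
have rb : -1 <= (i %% n)%:R * rho <= 1.
  have r0 : 0 <= (i %% n)%:R :> R by [].
  have rn : (i %% n)%:R <= n%:R :> R by rewrite ler_nat ltnW // ltn_pmod.
  have [rho0|rho0] := leP 0 rho; nra.
have := xI i; rewrite /I /= ei intrB intrD.
have := ui (i %% n)%N; have := vi (i %% n)%N; have := Si (i %/ n)%N; lra.
Qed.

(** * Large orbits *)

Unset Implicit Arguments.

Theorem theorem2p2 (R : realType) (d : int) (F : R -> R) (n : nat)
    (P : set R) (maxP minP : R)
    (hd : 1 <= d)
    (hF : lifting_of_degree d F)
    (hP : periodic_orbit F n P)
    (hmax : is_max P maxP)
    (hmin : is_min P minP)
    (hdiam : 1 < maxP - minP) :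
  (d = 1 ->
     `[- (1 / n%:R), 1 / n%:R] `<=` rotation_interval F /\ all_periods F) /\
  (2 <= d -> all_periods F).
Proof.
have [cF F1] := hF; have [PM geM] := hmax; have [Pm lem] := hmin.
have [Pitm [j jn Fj]] := periodic_orbit_connected hP Pm PM.
have [PitM [j' jn' Fj']] := periodic_orbit_connected hP PM Pm.
have ab : minP + 1 < maxP by lra.
split=> [d1|d2].
  rewrite d1 in hF F1; split => [rho /=|].
    rewrite in_itv /= => rhoi.
    have n0 : (0 < n)%N by case: hP => x [].
    apply: (drift_rotation_numbers hF n0 ab Fj jn _ Fj' jn' _ rhoi).
      by move=> i; rewrite lem ?geM.
    by move=> i; rewrite lem ?geM.
  apply: drift_all_periods => // t.
    exact: (drift_up t hF Fj ab).
  exact: (drift_down t hF Fj' ab).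
apply: (expanding_all_periods d2 hF Fj (fun i => lem _ (Pitm i)) _ _ ab).
  rewrite lt_neqAle (lem _ (Pitm 1%N)) andbT; apply/eqP => fixm.
  by have := iter_fix j (esym fixm); rewrite Fj; lra.
exact: geM (PitM 1%N).
Qed.
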